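(* Let $n\ge 2$, let $P=(p_1,\dots,p_n)$, $Q=(q_1,\dots,q_n)\in\Gamma_n$, and let $r,R$ be real numbers with $0<r\le \frac{p_i}{q_i}\le R<\infty$ for all $i\in\{1,\dots,n\}$. Then for every real $s\le -1$, $$\frac{r^{1-s}}{(r+1)^2}\,\Phi_s(P\|Q)\ \le\ F(P\|Q)\ \le\ \frac{R^{1-s}}{(R+1)^2}\,\Phi_s(P\|Q),$$ and for every real $s\ge 1$, $$\frac{R^{1-s}}{(R+1)^2}\,\Phi_s(P\|Q)\ \le\ F(P\|Q)\ \le\ \frac{r^{1-s}}{(r+1)^2}\,\Phi_s(P\|Q).$$
   Context: For $n\ge2$, $\Gamma_n=\{P=(p_1,\dots,p_n): p_i>0,\ \sum_{i=1}^n p_i=1\}$. For $P,Q\in\Gamma_n$ and $s\in\mathbb{R}$, the relative information of type $s$ is $\Phi_s(P\|Q)=[s(s-1)]^{-1}\left[\sum_{i=1}^n p_i^s q_i^{1-s}-1\right]$ for $s\ne 0,1$; $\Phi_0(P\|Q)=\sum_{i=1}^n q_i\ln\frac{q_i}{p_i}$; $\Phi_1(P\|Q)=\sum_{i=1}^n p_i\ln\frac{p_i}{q_i}$. The relative JS-divergence is $F(P\|Q)=\sum_{i=1}^n p_i\ln\left(\frac{2p_i}{p_i+q_i}\right)$. *)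

(* Defs.v *)
From HB Require Import structures.
From mathcomp Require Import all_boot all_order all_algebra.
From mathcomp Require Import all_classical all_reals all_analysis.

Set Implicit Arguments.
Unset Strict Implicit.
Unset Printing Implicit Defensive.

Import Order.TTheory GRing.Theory Num.Theory.
Local Open Scope ring_scope.

(* The open probability simplex; the condition n >= 2 is left to the users. *)
Definition Gamma {K : realType} (n : nat) : set ('I_n -> K) :=
  [set P | (forall i, 0 < P i) /\ \sum_(i < n) P i = 1]%classic.

(* Relative information of type s. The total functions ln and powR have their
   usual meaning on Gamma, where all entries are positive. *)
Definition Phi {K : realType} (n : nat) (s : K) (P Q : 'I_n -> K) : K :=
  if s == 0 then \sum_(i < n) Q i * ln (Q i / P i)
  else if s == 1 then \sum_(i < n) P i * ln (P i / Q i)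
  else (s * (s - 1))^-1 * ((\sum_(i < n) P i `^ s * Q i `^ (1 - s)) - 1).

(* Relative Jensen-Shannon divergence F(P||Q). *)
Definition relJS {K : realType} (n : nat) (P Q : 'I_n -> K) : K :=
  \sum_(i < n) P i * ln (2 * P i / (P i + Q i)).

(* Main.v *)
Require Import Defs.

From HB Require Import structures.
From mathcomp Require Import all_boot all_order all_algebra.
From mathcomp Require Import all_classical all_reals all_analysis.
From mathcomp Require Import ring lra.

(** Both divergences are Csiszar sums [\sum_i Q i * f (P i / Q i)] with
    [f 1 = 0]: [relJS] has the generator [x * ln (2 * x / (x + 1))] and [Phi s]
    has [(x `^ s - 1) / (s * (s - 1))], or [x * ln x] when [s = 1]. The second
    derivatives are [x^-1 / (x + 1) ^+ 2] and [x `^ (s - 2)], and their ratio is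
    the weight [x `^ (1 - s) / (x + 1) ^+ 2] that occurs in the bounds.

    If [f''] is at most [g''] on the interval that contains all the ratios
    [P i / Q i], then [g - f] is convex there, so it lies above its tangent at
    [1]; the weighted sum of that tangent is its value at [1], because
    [\sum_i Q i * (P i / Q i - 1) = 0]. Hence the sum of [f] is at most that of
    [g] ([csiszar_sum_le]). Applied to the generator of [relJS] and multiples of
    that of [Phi s], this bounds [relJS] by [Phi s] times a lower and an upper
    bound of the weight on [[r, R]] ([Phi_relJS_bounds]).

    It remains to see where the weight is extremal. The sign of its derivative
    is that of [(1 - s) - (1 + s) * x]: on the positive axis the weight is
    nondecreasing when [s <= -1] and nonincreasing when [1 <= s], which places
    the extrema at the end points [r] and [R] ([JS_weight_nd],
    [JS_weight_ni]). *)

Set Implicit Arguments.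
Unset Strict Implicit.
Unset Printing Implicit Defensive.

Import Order.TTheory GRing.Theory Num.Theory.
Import numFieldNormedType.Exports.
Local Open Scope ring_scope.

(** * Comparison of Csiszar sums through second derivatives *)

(** The mean value theorem applied to [h1] makes the slope nondecreasing; applied
    to [h], it writes the increment from [c] as a slope taken between [c] and
    [x], which is compared with [h1 c] on either side of [c]. *)
Lemma tangent_line_le (K : realType) (h h1 h2 : K -> K) (a b : K)
    (dh : forall x, x \in `[a, b] -> is_derive x 1 h (h1 x))
    (dh1 : forall x, x \in `[a, b] -> is_derive x 1 h1 (h2 x))
    (h2_ge0 : forall x, x \in `[a, b] -> 0 <= h2 x)
    (c x : K) (cab : c \in `[a, b]) (xab : x \in `[a, b]) :
  h c + h1 c * (x - c) <= h x.
Proof.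
have sub u v : u \in `[a, b] -> v \in `[a, b] ->
    forall z, z \in `[u, v] -> z \in `[a, b].
  rewrite !in_itv/= => /andP[au _] /andP[_ vb] z /andP[uz zv].
  by apply/andP; split; [exact: le_trans uz|exact: le_trans vb].
have mvt (g dg : K -> K) u v : u \in `[a, b] -> v \in `[a, b] ->
    (forall z, z \in `[a, b] -> is_derive z 1 g (dg z)) -> u <= v ->
    exists2 w, w \in `[u, v] & g v - g u = dg w * (v - u).
  move=> uab vab gdg uv; have uvab := sub u v uab vab.
  have gdg_oo z : z \in `]u, v[ -> is_derive z 1 g (dg z).
    by move=> zuv; apply/gdg/uvab; exact: subset_itv_oo_cc zuv.
  apply: (MVT_segment uv gdg_oo).
  by apply: derivable_within_continuous => z /uvab /gdg [].
have h1_nd u v : u \in `[a, b] -> v \in `[a, b] -> u <= v -> h1 u <= h1 v.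
  move=> uab vab uv; have [w wuv h1E] := mvt _ _ u v uab vab dh1 uv.
  by rewrite -subr_ge0 h1E mulr_ge0 ?subr_ge0// h2_ge0// (sub u v).
have [cx|/ltW xc] := leP c x.
- have [w wcx hE] := mvt _ _ c x cab xab dh cx.
  have wab := sub c x cab xab w wcx.
  move: wcx; rewrite in_itv/= => /andP[cw _].
  rewrite -lerBrDl hE ler_wpM2r ?subr_ge0//; exact: h1_nd.
- have [w wxc hE] := mvt _ _ x c xab cab dh xc.
  have wab := sub x c xab cab w wxc.
  move: wxc; rewrite in_itv/= => /andP[_ wc].
  have : h1 w * (c - x) <= h1 c * (c - x).
    by rewrite ler_wpM2r ?subr_ge0//; exact: h1_nd.
  by rewrite -hE; lra.
Qed.

(** Jensen's inequality for the weights [Q i] and the points [P i / Q i], whose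
    barycentre is [1]. *)
Lemma csiszar_sum_ge (K : realType) (n : nat) (P Q : 'I_n -> K)
    (GP : Gamma P) (GQ : Gamma Q) (r R : K)
    (rPQR : forall i, P i / Q i \in `[r, R]) (h h1 h2 : K -> K)
    (dh : forall x, x \in `[r, R] -> is_derive x 1 h (h1 x))
    (dh1 : forall x, x \in `[r, R] -> is_derive x 1 h1 (h2 x))
    (h2_ge0 : forall x, x \in `[r, R] -> 0 <= h2 x) :
  h 1 <= \sum_(i < n) Q i * h (P i / Q i).
Proof.
case: GP GQ => [P0 P1] [Q0 Q1].
have Q_neq0 i : Q i != 0 by rewrite gt_eqF.
have PE i : Q i * (P i / Q i) = P i by rewrite mulrC divfK.
(* [1] is a [Q]-weighted mean of the ratios, so it lies between their bounds. *)
have in1 : 1 \in `[r, R].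
  rewrite in_itv/=; apply/andP; split.
    rewrite -[r]mulr1 -{1}Q1 -P1 mulr_sumr; apply: ler_sum => i _.
    by rewrite -[leRHS]PE mulrC ler_pM2l//; have /itvP -> := rPQR i.
  rewrite -[R]mulr1 -{2}Q1 -P1 mulr_sumr; apply: ler_sum => i _.
  by rewrite -[leLHS]PE mulrC ler_pM2r//; have /itvP -> := rPQR i.
(* The slope terms cancel, since [\sum_i (P i - Q i) = 0]. *)
have -> : h 1 = \sum_(i < n) Q i * (h 1 + h1 1 * (P i / Q i - 1)).
  under eq_bigr => i _.
    rewrite (_ : _ * _ = (h 1 - h1 1) * Q i + h1 1 * P i); last first.
      by rewrite -{2}PE; ring.
    over.
  by rewrite big_split/= -!mulr_sumr P1 Q1; ring.
apply: ler_sum => i _; rewrite ler_pM2l//.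
exact: (@tangent_line_le _ h h1 h2 r R).
Qed.

(** [is_deriveZ] stated for a product written pointwise, the form in which the
    multiples of a generator appear below. *)
Lemma is_derive_mull (K : realType) (c : K) (f : K -> K) (x df : K) :
  is_derive x 1 f df -> is_derive x 1 (fun y => c * f y) (c * df).
Proof. exact: is_deriveZ. Qed.

Lemma csiszar_sum_le (K : realType) (n : nat) (P Q : 'I_n -> K)
    (GP : Gamma P) (GQ : Gamma Q) (r R : K)
    (rPQR : forall i, P i / Q i \in `[r, R]) (f f1 f2 g g1 g2 : K -> K)
    (df : forall x, x \in `[r, R] -> is_derive x 1 f (f1 x))
    (df1 : forall x, x \in `[r, R] -> is_derive x 1 f1 (f2 x))
    (dg : forall x, x \in `[r, R] -> is_derive x 1 g (g1 x))
    (dg1 : forall x, x \in `[r, R] -> is_derive x 1 g1 (g2 x))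
    (fg : f 1 = g 1)
    (f2_le_g2 : forall x, x \in `[r, R] -> f2 x <= g2 x) :
  \sum_(i < n) Q i * f (P i / Q i) <= \sum_(i < n) Q i * g (P i / Q i).
Proof.
rewrite -subr_ge0 -sumrB; under eq_bigr do rewrite -mulrBr.
have {1}-> : 0 = g 1 - f 1 by rewrite fg subrr.
apply: (csiszar_sum_ge GP GQ rPQR (h := fun x => g x - f x)
    (h1 := fun x => g1 x - f1 x) (h2 := fun x => g2 x - f2 x)) => x xrR.
- exact: is_deriveB (dg x xrR) (df x xrR).
- exact: is_deriveB (dg1 x xrR) (df1 x xrR).
- by rewrite subr_ge0 f2_le_g2.
Qed.

(** * The generator of the relative information of type s *)

Definition Phi_gen (K : realType) (s x : K) : K :=
  if s == 1 then x * ln x else (s * (s - 1))^-1 * (x `^ s - 1).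

Definition Phi_gen' (K : realType) (s x : K) : K :=
  if s == 1 then ln x + 1 else (s - 1)^-1 * x `^ (s - 1).

Lemma is_derive_Phi_gen (K : realType) (s x : K) :
  s != 0 -> 0 < x -> is_derive x 1 (Phi_gen s) (Phi_gen' s x).
Proof.
move=> s0 x0; rewrite /Phi_gen /Phi_gen'; case: (eqVneq s 1) => [_|s1].
  have dln := is_derive1_ln x0.
  apply: (is_derive_eq (f := id * @ln K) (is_deriveM (is_derive_id x (1 : K)) dln)).
  by rewrite /GRing.scale/= divff ?gt_eqF//; ring.
have dpow := is_derive1_powR s x0.
have := is_derive_mull (s * (s - 1))^-1 (is_deriveB dpow
  (is_derive_cst (1 : K) x 1)).
move=> d; apply: (is_derive_eq d).
by rewrite subr0; field; rewrite subr_eq0 s1 s0.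
Qed.

Lemma is_derive_Phi_gen' (K : realType) (s x : K) :
  0 < x -> is_derive x 1 (Phi_gen' s) (x `^ (s - 2)).
Proof.
move=> x0; rewrite /Phi_gen'; case: (eqVneq s 1) => [->|s1].
  have dln := is_derive1_ln x0.
  apply: (is_derive_eq (is_deriveD dln (is_derive_cst (1 : K) x 1))).
  by rewrite addr0 (_ : 1 - 2 = -1) ?powR_inv1 1?ltW//; ring.
have := is_derive_mull (s - 1)^-1 (is_derive1_powR (s - 1) x0).
move=> d; apply: (is_derive_eq d).
rewrite mulrA mulVf ?subr_eq0// mul1r.
by congr (_ `^ _); ring.
Qed.

Lemma PhiE (K : realType) (n : nat) (P Q : 'I_n -> K) (s : K)
    (GP : Gamma P) (GQ : Gamma Q) : s != 0 ->
  Phi s P Q = \sum_(i < n) Q i * Phi_gen s (P i / Q i).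
Proof.
case: GP GQ => [P0 P1] [Q0 Q1] s0; rewrite /Phi /Phi_gen (negPf s0).
case: eqP => [_|_].
  by apply: eq_bigr => i _; rewrite mulrA mulrCA divff ?gt_eqF// mulr1.
transitivity ((s * (s - 1))^-1 *
    (\sum_(i < n) P i `^ s * Q i `^ (1 - s) - \sum_(i < n) Q i)).
  by rewrite Q1.
rewrite -sumrB mulr_sumr; apply: eq_bigr => i _.
have QVE : (Q i)^-1 = Q i `^ (-1) by rewrite powR_inv1 ?ltW.
rewrite powRM ?ltW ?invr_gt0// QVE -powRrM.
rewrite powRD; last by rewrite (gt_eqF (Q0 i)) implybT.
by rewrite powRr1 ?ltW// mulN1r; ring.
Qed.

(** * The generator of the relative Jensen-Shannon divergence *)

(** [ln (2 * x / (x + 1))] is expanded into a sum of logarithms, which agrees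
    with it for [0 < x] only but can be differentiated term by term. *)
Definition JS_gen (K : realType) (x : K) : K :=
  x * (ln 2 + ln x - ln (x + 1)).

Definition JS_gen' (K : realType) (x : K) : K :=
  ln 2 + ln x - ln (x + 1) + (x + 1)^-1.

Lemma is_derive_ln_add1 (K : realType) (x : K) :
  0 < x -> is_derive x 1 (fun y : K => ln (y + 1)) (x + 1)^-1.
Proof.
move=> x0; have x10 : 0 < x + 1 by rewrite addr_gt0.
have dln : is_derive (x + 1) 1 (@ln K) (x + 1)^-1 by exact: is_derive1_ln.
have dshift := is_deriveD (is_derive_id x (1 : K)) (is_derive_cst (1 : K) x 1).
apply: (is_derive_eq (is_derive1_comp (g := id + cst 1) dln dshift)).
by rewrite addr0 mulr1.
Qed.

Lemma is_derive_JS_log (K : realType) (x : K) : 0 < x ->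
  is_derive x 1 (fun y : K => ln 2 + ln y - ln (y + 1)) (x^-1 - (x + 1)^-1).
Proof.
move=> x0.
have d := is_deriveB (is_deriveD (is_derive_cst (ln 2 : K) x 1)
  (is_derive1_ln x0)) (is_derive_ln_add1 x0).
by apply: (is_derive_eq d); rewrite add0r.
Qed.

Lemma is_derive_JS_gen (K : realType) (x : K) :
  0 < x -> is_derive x 1 (@JS_gen K) (JS_gen' x).
Proof.
move=> x0; have dlog := is_derive_JS_log x0.
apply: (is_derive_eq (is_deriveM (is_derive_id x (1 : K)) dlog)).
rewrite /JS_gen' /GRing.scale/=; field.
by rewrite !gt_eqF ?addr_gt0.
Qed.

Lemma is_derive_JS_gen' (K : realType) (x : K) :
  0 < x -> is_derive x 1 (@JS_gen' K) (x^-1 / (x + 1) ^+ 2).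
Proof.
move=> x0; have x10 : x + 1 != 0 by rewrite gt_eqF ?addr_gt0.
have dshift := is_deriveD (is_derive_id x (1 : K)) (is_derive_cst (1 : K) x 1).
have dinv := is_deriveV (f := id + cst 1) x10 dshift.
apply: (is_derive_eq (is_deriveD (is_derive_JS_log x0) dinv)).
rewrite /GRing.scale/= (_ : (id + cst 1) x = x + 1)//; field.
by rewrite x10 gt_eqF.
Qed.

Lemma relJSE (K : realType) (n : nat) (P Q : 'I_n -> K)
    (GP : Gamma P) (GQ : Gamma Q) :
  relJS P Q = \sum_(i < n) Q i * JS_gen (P i / Q i).
Proof.
case: GP GQ => [P0 _] [Q0 _]; apply: eq_bigr => i _.
have [p0 q0] := (P0 i, Q0 i).
have x0 : 0 < P i / Q i by rewrite divr_gt0.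
have x10 : 0 < P i / Q i + 1 by rewrite addr_gt0.
rewrite /JS_gen -lnM ?posrE// -ln_div ?posrE//; last exact: mulr_gt0.
rewrite mulrA [Q i * _]mulrC divfK ?gt_eqF//; congr (_ * ln _).
by field; rewrite !gt_eqF ?addr_gt0.
Qed.

(** * The ratio of the second derivatives *)

Definition JS_weight (K : realType) (s x : K) : K :=
  x `^ (1 - s) / (x + 1) ^+ 2.

Lemma JS_weightE (K : realType) (s x : K) :
  0 < x -> x^-1 / (x + 1) ^+ 2 = JS_weight s x * x `^ (s - 2).
Proof.
move=> x0; rewrite /JS_weight mulrAC -powRD; last first.
  by rewrite (gt_eqF x0) implybT.
by rewrite (_ : 1 - s + (s - 2) = -1) ?powR_inv1 ?ltW//; ring.
Qed.

(** The weight is the product of [x `^ (-1 - s)] and [(x / (x + 1)) ^+ 2]. Both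
    factors are nondecreasing, the first because its exponent is nonnegative. *)
Lemma JS_weight_nd (K : realType) (s x y : K) :
  s <= -1 -> 0 < x -> x <= y -> JS_weight s x <= JS_weight s y.
Proof.
move=> s1 x0 xy; have y0 := lt_le_trans x0 xy.
have E z : 0 < z -> JS_weight s z = z `^ (- 1 - s) * (z / (z + 1)) ^+ 2.
  move=> z0; rewrite /JS_weight expr_div_n -(@powR_mulrn _ z 2) ?ltW// mulrA.
  rewrite -powRD; last by rewrite (gt_eqF z0) implybT.
  by congr (_ `^ _ / _); ring.
rewrite !E//; apply: ler_pM.
- exact: powR_ge0.
- by rewrite exprn_ge0 // divr_ge0 ?addr_ge0 ?ltW.
- by apply: ge0_ler_powR; rewrite ?nnegrE ?(ltW x0) ?(ltW y0)//; lra.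
- rewrite lerXn2r ?nnegrE ?divr_ge0 ?addr_ge0 ?(ltW x0) ?(ltW y0)//.
  rewrite ler_pdivrMr ?addr_gt0// mulrAC ler_pdivlMr ?addr_gt0//.
  by lra.
Qed.

(** Both factors [x `^ (1 - s)] and [(x + 1) ^- 2] are nonincreasing. *)
Lemma JS_weight_ni (K : realType) (s x y : K) :
  1 <= s -> 0 < x -> x <= y -> JS_weight s y <= JS_weight s x.
Proof.
move=> s1 x0 xy; have y0 := lt_le_trans x0 xy.
rewrite /JS_weight -opprB !powRN; apply: ler_pM.
- by rewrite invr_ge0 powR_ge0.
- by rewrite invr_ge0 exprn_ge0// addr_ge0 ?ltW.
- rewrite lef_pV2 ?posrE ?powR_gt0//.
  by apply: ge0_ler_powR; rewrite ?nnegrE ?(ltW x0) ?(ltW y0)//; lra.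
- rewrite lef_pV2 ?posrE ?exprn_gt0 ?addr_gt0//.
  by rewrite lerXn2r ?nnegrE ?addr_ge0 ?(ltW x0) ?(ltW y0)// lerD2r.
Qed.

(** [m] and [M] stay free here because the end points of [[r, R]] exchange their
    roles between the two ranges of [s]. *)
Lemma Phi_relJS_bounds (K : realType) (n : nat) (P Q : 'I_n -> K)
    (GP : Gamma P) (GQ : Gamma Q) (r R : K) (r_gt0 : 0 < r)
    (rPQR : forall i, P i / Q i \in `[r, R]) (s : K) (s_neq0 : s != 0)
    (m M : K)
    (mM : forall x, x \in `[r, R] -> m <= JS_weight s x <= M) :
  m * Phi s P Q <= relJS P Q /\ relJS P Q <= M * Phi s P Q.
Proof.
have pos x : x \in `[r, R] -> 0 < x.
  by rewrite in_itv/= => /andP[rx _]; exact: lt_le_trans rx.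
have dJ x (xrR : x \in `[r, R]) := is_derive_JS_gen (pos x xrR).
have dJ' x (xrR : x \in `[r, R]) := is_derive_JS_gen' (pos x xrR).
have dP c x (xrR : x \in `[r, R]) :=
  is_derive_mull c (is_derive_Phi_gen s_neq0 (pos x xrR)).
have dP' c x (xrR : x \in `[r, R]) :=
  is_derive_mull c (is_derive_Phi_gen' s (pos x xrR)).
(* All generators vanish at [1], which gives the common value there. *)
have at1 c : c * Phi_gen s 1 = JS_gen 1.
  rewrite /Phi_gen /JS_gen ln1 powR1 subrr !mulr0 addr0.
  by rewrite (_ : 1 + 1 = 2)// subrr mulr0 if_same mulr0.
have scale c : c * Phi s P Q = \sum_(i < n) Q i * (c * Phi_gen s (P i / Q i)).
  by rewrite PhiE// mulr_sumr; apply: eq_bigr => i _; rewrite mulrCA.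
rewrite !scale relJSE//; split.
- apply: (csiszar_sum_le GP GQ rPQR
    (dP m) (dP' m) dJ dJ' (at1 m)) => x xrR.
  rewrite (JS_weightE s) ?pos// ler_wpM2r ?powR_ge0//.
  by have /andP[] := mM x xrR.
- apply: (csiszar_sum_le GP GQ rPQR
    dJ dJ' (dP M) (dP' M) (esym (at1 M))) => x xrR.
  rewrite (JS_weightE s) ?pos// ler_wpM2r ?powR_ge0//.
  by have /andP[] := mM x xrR.
Qed.

Unset Implicit Arguments.

Theorem theorem4p3 (K : realType) (n : nat) (n_ge2 : (2 <= n)%N)
    (P Q : 'I_n -> K) (GP : Gamma P) (GQ : Gamma Q)
    (r R : K) (r_gt0 : 0 < r)
    (rPQR : forall i : 'I_n, r <= P i / Q i /\ P i / Q i <= R) :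
  (forall s : K, s <= -1 ->
     r `^ (1 - s) / (r + 1) ^+ 2 * Phi s P Q <= relJS P Q /\
     relJS P Q <= R `^ (1 - s) / (R + 1) ^+ 2 * Phi s P Q) /\
  (forall s : K, 1 <= s ->
     R `^ (1 - s) / (R + 1) ^+ 2 * Phi s P Q <= relJS P Q /\
     relJS P Q <= r `^ (1 - s) / (r + 1) ^+ 2 * Phi s P Q).
Proof.
have rPQR' i : P i / Q i \in `[r, R] by rewrite in_itv/=; apply/andP.
have pos x : r <= x -> 0 < x by exact: lt_le_trans.
split=> s s1; apply: (Phi_relJS_bounds GP GQ r_gt0 rPQR').
- by rewrite lt_eqF//; lra.
- move=> x; rewrite in_itv/= => /andP[rx xR].
  by apply/andP; split; apply: JS_weight_nd => //; exact: pos.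
- by rewrite gt_eqF//; lra.
- move=> x; rewrite in_itv/= => /andP[rx xR].
  by apply/andP; split; apply: JS_weight_ni => //; exact: pos.
Qed.
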